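(* Let $u=(p_{\mathrm{g,ref}},v_{\mathrm g})$ be a dispatch point and let $\gamma\ge 0$. Suppose there exist internal state bounds $z^u=(\varphi^u,v^u_{\mathrm{pq}},\Delta^u)$, $z^\ell=(\varphi^\ell,v^\ell_{\mathrm{pq}},\Delta^\ell)$ in $\mathbb{R}^{n_{\mathrm l}+n_{\mathrm{pq}}+1}$ with $z^\ell\le z^u$, such that $v_k^{\min}\le v_k^\ell$ and $v_k^u\le v_k^{\max}$ for every bus $k$ and $\varphi_l^{\min}\le\varphi_l^\ell$ and $\varphi_l^u\le\varphi_l^{\max}$ for every line $l$, and residual bounds $g^u_{\mathcal P},g^\ell_{\mathcal P}\in\mathbb{R}^{n_{\mathrm g}+2n_{\mathrm l}+n_{\mathrm b}}$, with components $(g_{\mathcal P}^{\mathrm p,\cdot},g_{\mathcal P}^{\cos,\cdot},g_{\mathcal P}^{\sin,\cdot},g_{\mathcal P}^{\mathrm v,\cdot})$, satisfying both of the following. (1) For all $i=1,\dots,n_{\mathrm g}$, $l=1,\dots,n_{\mathrm l}$, $k=1,\dots,n_{\mathrm b}$, and all vertices $v_l^{\mathrm f}\in\{v_l^{\mathrm f,\ell},v_l^{\mathrm f,u}\}$, $v_l^{\mathrm t}\in\{v_l^{\mathrm t,\ell},v_l^{\mathrm t,u}\}$, $\varphi_l\in\{\varphi_l^\ell,\varphi_l^u\}$, $v_k\in\{v_k^\ell,v_k^u\}$: $$g_{\mathcal P,i}^{\mathrm p,\ell}\le g_i^{\mathrm p,\ell}(p_{\mathrm{g,ref},i}),\quad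 g_i^{\mathrm p,u}(p_{\mathrm{g,ref},i})\le g_{\mathcal P,i}^{\mathrm p,u},$$ $$g_{\mathcal P,l}^{\cos,\ell}\le g_l^{\cos,\ell}(v_l^{\mathrm f},v_l^{\mathrm t},\varphi_l),\quad g_l^{\cos,u}(v_l^{\mathrm f},v_l^{\mathrm t},\varphi_l)\le g_{\mathcal P,l}^{\cos,u},$$ $$g_{\mathcal P,l}^{\sin,\ell}\le g_l^{\sin,\ell}(v_l^{\mathrm f},v_l^{\mathrm t},\varphi_l),\quad g_l^{\sin,u}(v_l^{\mathrm f},v_l^{\mathrm t},\varphi_l)\le g_{\mathcal P,l}^{\sin,u},$$ $$g_{\mathcal P,k}^{\mathrm v,\ell}\le g_k^{\mathrm v,\ell}(v_k),\quad g_k^{\mathrm v,u}(v_k)\le g_{\mathcal P,k}^{\mathrm v,u}.$$ (2) Componentwise, $$K^+g^u_{\mathcal P}+K^-g^\ell_{\mathcal P}+\xi^u(\gamma)\le z^u,\qquad K^+g^\ell_{\mathcal P}+K^-g^u_{\mathcal P}+\xi^\ell(\gamma)\ge z^\ell,$$ where, for $i=1,\dots,n_{\mathrm l}+n_{\mathrm{pq}}+1$, $$\xi^u_i(\gamma)=-A_iJ_{f,(0)}^{-1}Rw^{(0)}+\gamma\lVert A_iJ_{f,(0)}^{-1}R\,\Sigma^{1/2}\rVert_2,\qquad \xi^\ell_i(\gamma)=-A_iJ_{f,(0)}^{-1}Rw^{(0)}-\gamma\lVert A_iJ_{f,(0)}^{-1}R\,\Sigma^{1/2}\rVert_2 .$$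 Then for every $w\in\mathcal W(\gamma)$ there exists an internal state $x\in\mathcal P(z^u,z^\ell)$ that solves the AC power flow equations $M\psi(x,u)+Rw=0$.
   Context: **Network.** A power grid has $n_{\mathrm b}$ buses, $n_{\mathrm l}$ lines, $n_{\mathrm g}$ generators and $n_{\mathrm d}$ loads. Each line $l$ has a from bus and a to bus; superscripts $\mathrm f,\mathrm t$ with index $l$ denote quantities at these buses (e.g. $v_l^{\mathrm f}$ is the voltage magnitude at the from bus of $l$). Buses are split into PV buses (those with generators) and PQ buses (the other $n_{\mathrm{pq}}$ buses). $E\in\mathbb{R}^{n_{\mathrm b}\times n_{\mathrm l}}$ is the incidence matrix ($+1$ at the from bus, $-1$ at the to bus of each line). $C_{\mathrm g}\in\mathbb{R}^{n_{\mathrm b}\times n_{\mathrm g}}$ and $C_{\mathrm d}\in\mathbb{R}^{n_{\mathrm b}\times n_{\mathrm d}}$ are the 0/1 connection matrices of generators and loads. $G^{\mathrm c},G^{\mathrm s},B^{\mathrm c},B^{\mathrm s}\in\mathbb{R}^{n_{\mathrm b}\times n_{\mathrm l}}$ and diagonal $G^{\mathrm d},B^{\mathrm d}\in\mathbb{R}^{n_{\mathrm b}\times n_{\mathrm b}}$ are given real (transformed admittance) matrices. Subscript $\mathrm{pq}$ on a matrix selects the rows of PQ buses. One bus is the reference, with angle $0$; subscript $\mathrm{ns}$ selects non-reference buses. **Variables.** Dispatch point: $u=(p_{\mathrm{g,ref}},v_{\mathrm g})\in\mathbb{R}^{2n_{\mathrm g}}$ (active power setpoints and voltage magnitudes at generator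 buses; generators at the same bus share the same voltage setpoint). Uncertain variable: $w=(p_{\mathrm d},q_{\mathrm d})\in\mathbb{R}^{2n_{\mathrm d}}$. Internal state: $x=(\theta_{\mathrm{ns}},v_{\mathrm{pq}},\Delta)\in\mathbb{R}^{n_{\mathrm b}+n_{\mathrm{pq}}}$ (angles, PQ voltage magnitudes, power imbalance). Angle differences are $\varphi=E_{\mathrm{ns}}^T\theta_{\mathrm{ns}}\in\mathbb{R}^{n_{\mathrm l}}$. Put $A=\mathbf{blkdiag}(E_{\mathrm{ns}}^T,I_{n_{\mathrm{pq}}},1)$, so $Ax=(\varphi,v_{\mathrm{pq}},\Delta)$; $A_i$ is its $i$-th row. Participation factors $\alpha_i$ ($i=1,\dots,n_{\mathrm g}$) are fixed constants; generator $i$ outputs $p_{\mathrm g,i}=p_{\mathrm{g,ref},i}+\alpha_i\Delta$. **Power flow.** Basis function $\psi(x,u)=(\psi^{\mathrm p},\psi^{\cos},\psi^{\sin},\psi^{\mathrm{quad}})\in\mathbb{R}^{n_{\mathrm g}+2n_{\mathrm l}+n_{\mathrm b}}$, where $\psi_i^{\mathrm p}=p_{\mathrm{g,ref},i}+\alpha_i\Delta$, $\psi_l^{\cos}=v_l^{\mathrm f}v_l^{\mathrm t}\cos\varphi_l$, $\psi_l^{\sin}=v_l^{\mathrm f}v_l^{\mathrm t}\sin\varphi_l$, $\psi_k^{\mathrm{quad}}=v_k^2$. The AC power flow equations (active balance at all buses, reactive balance at PQ buses) are $M\psi(x,u)+Rw=0$ with $$M=\begin{bmatrix}C_{\mathrm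 g}&-G^{\mathrm c}&-B^{\mathrm s}&-G^{\mathrm d}\\ \mathbf 0&B^{\mathrm c}_{\mathrm{pq}}&-G^{\mathrm s}_{\mathrm{pq}}&B^{\mathrm d}_{\mathrm{pq}}\end{bmatrix},\qquad R=-\begin{bmatrix}C_{\mathrm d}&\mathbf 0\\ \mathbf 0&C_{\mathrm{d,pq}}\end{bmatrix}.$$ **Uncertainty set.** $\mathcal W(\gamma)=\{w\mid (w-w^{(0)})^T\Sigma^{-1}(w-w^{(0)})\le\gamma^2\}$ with nominal value $w^{(0)}$, $\Sigma$ symmetric positive definite, and $\Sigma^{1/2}$ its Cholesky factor, $\Sigma=\Sigma^{1/2}(\Sigma^{1/2})^T$. **Nominal point and Jacobians.** $(x^{(0)},u^{(0)})$ is a fixed nominal operating point solving the power flow equations with $w=w^{(0)}$. $J_{\psi,(0)}=\nabla_x\psi|_{(x^{(0)},u^{(0)})}$ and $J_{f,(0)}=MJ_{\psi,(0)}$, which is assumed non-singular. $K=-AJ_{f,(0)}^{-1}M$; $K^+_{ij}=\max\{K_{ij},0\}$, $K^-_{ij}=\min\{K_{ij},0\}$. **Residuals and envelopes.** The residual is $g(x,u)=\psi(x,u)-J_{\psi,(0)}x$, with blocks $g^{\mathrm p},g^{\cos},g^{\sin},g^{\mathrm v}$ (residuals of $\psi^{\mathrm p},\psi^{\cos},\psi^{\sin},\psi^{\mathrm{quad}}$); $g_i^{\mathrm p}$ depends only on $p_{\mathrm{g,ref},i}$ (indeed $g_i^{\mathrm p}=p_{\mathrm{g,ref},i}$), $g_l^{\cos},g_l^{\sin}$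 only on $(v_l^{\mathrm f},v_l^{\mathrm t},\varphi_l)$, and $g_k^{\mathrm v}$ only on $v_k$. For each component, fixed functions of the same arguments with superscripts $\ell$ (concave) and $u$ (convex) are given, satisfying $g^{\ell}\le g\le g^{u}$ for all arguments within the operational limits $v_k^{\min}\le v_k\le v_k^{\max}$, $\varphi_l^{\min}\le\varphi_l\le\varphi_l^{\max}$ (and all values of $p_{\mathrm{g,ref},i}$). **State bounds.** $\mathcal P(z^u,z^\ell)=\{x\mid z^\ell\le Ax\le z^u\}$. For a PQ bus $k$, $v_k^\ell,v_k^u$ are the corresponding entries of $v_{\mathrm{pq}}^\ell,v_{\mathrm{pq}}^u$; for a PV bus, $v_k^\ell=v_k^u$ equals the setpoint in $v_{\mathrm g}$. $v_l^{\mathrm f,\ell}$ etc. denote these bounds at the from/to bus of line $l$. Vector inequalities are componentwise. *)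

(* Defs.v *)
From HB Require Import structures.
From mathcomp Require Import all_boot all_order all_algebra.
From mathcomp Require Import all_classical all_reals all_analysis.

Set Implicit Arguments.
Unset Strict Implicit.
Unset Printing Implicit Defensive.

Import Order.TTheory GRing.Theory Num.Theory.
Import numFieldNormedType.Exports.
Local Open Scope ring_scope.

Definition lev (R : realType) n (a b : 'cV[R]_n) : Prop :=
  forall i, a i 0 <= b i 0.

Definition norm2 (R : realType) n (a : 'rV[R]_n) : R :=
  Num.sqrt (\sum_j a 0 j ^+ 2).

Definition pos_part (R : realType) m n (A : 'M[R]_(m, n)) : 'M[R]_(m, n) :=
  map_mx (fun a => Num.max a 0) A.
Definition neg_part (R : realType) m n (A : 'M[R]_(m, n)) : 'M[R]_(m, n) :=
  map_mx (fun a => Num.min a 0) A.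

Definition sym_posdef (R : realType) n (S : 'M[R]_n) : Prop :=
  S^T = S /\ forall a : 'cV[R]_n, a != 0 -> 0 < (a^T *m S *m a) 0 0.

(* [is_trig_mx] means lower triangular; positivity of the diagonal makes the
   factor unique. *)
Definition cholesky_factor (R : realType) n (S L : 'M[R]_n) : Prop :=
  [/\ is_trig_mx L, forall i, 0 < L i i & S = L *m L^T].

(* PV buses are the values of [gen_bus], PQ buses all the others.  The incidence
   and connection matrices are derived from the maps into buses. *)
Record network (R : realType) (nb nl ng nd : nat) := Network {
  line_from : 'I_nl -> 'I_nb;
  line_to   : 'I_nl -> 'I_nb;
  line_from_neq_to : forall l, line_from l != line_to l;
  gen_bus   : 'I_ng -> 'I_nb;
  load_bus  : 'I_nd -> 'I_nb;
  ref_bus   : 'I_nb;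
  Gc : 'M[R]_(nb, nl);
  Gs : 'M[R]_(nb, nl);
  Bc : 'M[R]_(nb, nl);
  Bs : 'M[R]_(nb, nl);
  Gd : 'M[R]_nb;
  Bd : 'M[R]_nb;
  Gd_diag : is_diag_mx Gd;
  Bd_diag : is_diag_mx Bd;
  alpha  : 'cV[R]_ng;
  vmin   : 'cV[R]_nb;
  vmax   : 'cV[R]_nb;
  phimin : 'cV[R]_nl;
  phimax : 'cV[R]_nl }.

Section Network.
Variables (R : realType) (nb nl ng nd : nat) (N : network R nb nl ng nd).

Definition pq_set : {set 'I_nb} := ~: [set gen_bus N i | i : 'I_ng].
Definition npq : nat := #|pq_set|.
Definition pq_bus (j : 'I_npq) : 'I_nb := enum_val j.

Definition pq_rows n (B : 'M[R]_(nb, n)) : 'M[R]_(npq, n) := rowsub pq_bus B.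
Definition ns_rows n (B : 'M[R]_(nb, n)) : 'M[R]_(nb.-1, n) :=
  row' (ref_bus N) B.

Definition incidence : 'M[R]_(nb, nl) :=
  \matrix_(k, l) ((k == line_from N l)%:R - (k == line_to N l)%:R).
Definition Cg : 'M[R]_(nb, ng) := \matrix_(k, i) (k == gen_bus N i)%:R.
Definition Cd : 'M[R]_(nb, nd) := \matrix_(k, i) (k == load_bus N i)%:R.

Definition nx : nat := (nb.-1 + (npq + 1))%N.
Definition neq : nat := (nb + npq)%N.
Definition nz : nat := (nl + (npq + 1))%N.
Definition npsi : nat := (ng + (nl + (nl + nb)))%N.

Definition x_theta (x : 'cV[R]_nx) : 'cV[R]_(nb.-1) := usubmx x.
Definition x_vpq (x : 'cV[R]_nx) : 'cV[R]_npq := usubmx (dsubmx x).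
Definition x_Delta (x : 'cV[R]_nx) : R := dsubmx (dsubmx x) 0 0.

Definition z_phi (z : 'cV[R]_nz) : 'cV[R]_nl := usubmx z.
Definition z_vpq (z : 'cV[R]_nz) : 'cV[R]_npq := usubmx (dsubmx z).

Definition u_pref (u : 'cV[R]_(ng + ng)) : 'cV[R]_ng := usubmx u.
Definition u_vg (u : 'cV[R]_(ng + ng)) : 'cV[R]_ng := dsubmx u.

Definition blk_p (g : 'cV[R]_npsi) : 'cV[R]_ng := usubmx g.
Definition blk_cos (g : 'cV[R]_npsi) : 'cV[R]_nl := usubmx (dsubmx g).
Definition blk_sin (g : 'cV[R]_npsi) : 'cV[R]_nl := usubmx (dsubmx (dsubmx g)).
Definition blk_quad (g : 'cV[R]_npsi) : 'cV[R]_nb :=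
  dsubmx (dsubmx (dsubmx g)).

Definition dispatch_point (u : 'cV[R]_(ng + ng)) : Prop :=
  forall i j, gen_bus N i = gen_bus N j -> u_vg u i 0 = u_vg u j 0.

(* For a dispatch point, the choice of a generator at a PV bus is immaterial;
   every bus is either a generator bus or of the form [pq_bus j], so the last
   branch is never reached. *)
Definition bus_v (vpq : 'cV[R]_npq) (u : 'cV[R]_(ng + ng)) (k : 'I_nb) : R :=
  if [pick i | gen_bus N i == k] is Some i then u_vg u i 0
  else if [pick j | pq_bus j == k] is Some j then vpq j 0 else 0.

Definition x_phi (x : 'cV[R]_nx) : 'cV[R]_nl :=
  (ns_rows incidence)^T *m x_theta x.

Definition psi (x : 'cV[R]_nx) (u : 'cV[R]_(ng + ng)) : 'cV[R]_npsi :=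
  let v := bus_v (x_vpq x) u in
  let vf l := v (line_from N l) in
  let vt l := v (line_to N l) in
  let phi l := x_phi x l 0 in
  col_mx (\col_i (u_pref u i 0 + alpha N i 0 * x_Delta x))
    (col_mx (\col_l (vf l * vt l * cos (phi l)))
      (col_mx (\col_l (vf l * vt l * sin (phi l)))
        (\col_k (v k ^+ 2)))).

Definition Mmx : 'M[R]_(neq, npsi) :=
  col_mx
    (row_mx Cg (row_mx (- Gc N) (row_mx (- Bs N) (- Gd N))))
    (row_mx 0 (row_mx (pq_rows (Bc N))
                (row_mx (- pq_rows (Gs N)) (pq_rows (Bd N))))).

Definition Rmx : 'M[R]_(neq, nd + nd) := - block_mx Cd 0 0 (pq_rows Cd).

Definition power_flow x u (w : 'cV[R]_(nd + nd)) : Prop :=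
  Mmx *m psi x u + Rmx *m w = 0.

Definition Amx : 'M[R]_(nz, nx) :=
  block_mx (ns_rows incidence)^T 0 0
           (block_mx (1%:M : 'M[R]_npq) 0 0 (1%:M : 'M[R]_1)).

Definition state_set (zu zl : 'cV[R]_nz) : set 'cV[R]_nx :=
  [set x | lev zl (Amx *m x) /\ lev (Amx *m x) zu]%classic.

Definition Jpsi (x0 : 'cV[R]_nx) (u0 : 'cV[R]_(ng + ng)) : 'M[R]_(npsi, nx) :=
  \matrix_(i, j) 'D_(delta_mx j 0 : 'cV[R]_nx)
                    (fun x : 'cV[R]_nx => psi x u0 i 0 : R^o) x0.

Definition Jf x0 u0 : 'M[R]_(neq, nx) := Mmx *m Jpsi x0 u0.

Lemma neq_nx : neq = nx.
Proof.
rewrite /neq /nx addn1 addnS -addSn prednK //.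
exact: leq_ltn_trans (leq0n _) (ltn_ord (ref_bus N)).
Qed.

(* [Jf] is square only up to [neq_nx]: n_b + n_pq = (n_b - 1) + (n_pq + 1). *)
Definition Jf_sq x0 u0 : 'M[R]_nx := castmx (neq_nx, erefl nx) (Jf x0 u0).
Definition Jf_inv x0 u0 : 'M[R]_(nx, neq) :=
  castmx (erefl nx, esym neq_nx) (invmx (Jf_sq x0 u0)).

Definition Kmx x0 u0 : 'M[R]_(nz, npsi) := - (Amx *m Jf_inv x0 u0 *m Mmx).

Definition residual x0 u0 x u : 'cV[R]_npsi := psi x u - Jpsi x0 u0 *m x.

Definition xi_up x0 u0 (w0 : 'cV[R]_(nd + nd)) (L : 'M[R]_(nd + nd))
    (gamma : R) : 'cV[R]_nz :=
  \col_i (- (row i Amx *m Jf_inv x0 u0 *m Rmx *m w0) 0 0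
          + gamma * norm2 (row i Amx *m Jf_inv x0 u0 *m Rmx *m L)).
Definition xi_lo x0 u0 (w0 : 'cV[R]_(nd + nd)) (L : 'M[R]_(nd + nd))
    (gamma : R) : 'cV[R]_nz :=
  \col_i (- (row i Amx *m Jf_inv x0 u0 *m Rmx *m w0) 0 0
          - gamma * norm2 (row i Amx *m Jf_inv x0 u0 *m Rmx *m L)).

End Network.

Definition uncertainty_set (R : realType) n (w0 : 'cV[R]_n) (S : 'M[R]_n)
    (gamma : R) : set 'cV[R]_n :=
  [set w | ((w - w0)^T *m invmx S *m (w - w0)) 0 0 <= gamma ^+ 2]%classic.

(* Line envelopes take the arguments v^f, v^t, phi in this order. *)
Record envelopes (R : realType) (nb nl ng : nat) := Envelopes {
  gp_lo   : 'I_ng -> R -> R;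
  gp_up   : 'I_ng -> R -> R;
  gcos_lo : 'I_nl -> R -> R -> R -> R;
  gcos_up : 'I_nl -> R -> R -> R -> R;
  gsin_lo : 'I_nl -> R -> R -> R -> R;
  gsin_up : 'I_nl -> R -> R -> R -> R;
  gv_lo   : 'I_nb -> R -> R;
  gv_up   : 'I_nb -> R -> R }.

Definition convex1 (R : realType) (f : R -> R) : Prop :=
  @convex_function R R^o [set: _]%classic f.
Definition concave1 (R : realType) (f : R -> R) : Prop :=
  convex1 (fun a => - f a).

Definition convex3 (R : realType) (f : R -> R -> R -> R) : Prop :=
  @convex_function R (R^o * R^o * R^o)%type [set: _]%classic
    (fun a => f a.1.1 a.1.2 a.2).
Definition concave3 (R : realType) (f : R -> R -> R -> R) : Prop :=
  convex3 (fun a b c => - f a b c).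

Record envelope_shape (R : realType) (nb nl ng : nat)
    (e : envelopes R nb nl ng) : Prop := EnvelopeShape {
  gp_lo_concave   : forall i, concave1 (gp_lo e i);
  gp_up_convex    : forall i, convex1 (gp_up e i);
  gcos_lo_concave : forall l, concave3 (gcos_lo e l);
  gcos_up_convex  : forall l, convex3 (gcos_up e l);
  gsin_lo_concave : forall l, concave3 (gsin_lo e l);
  gsin_up_convex  : forall l, convex3 (gsin_up e l);
  gv_lo_concave   : forall k, concave1 (gv_lo e k);
  gv_up_convex    : forall k, convex1 (gv_up e k) }.

(* Since the two ends of a line are distinct, letting (x, u) range over all
   states and dispatch points lets the arguments of each single component of
   the residual range over all the values it can depend on. *)
Definition envelope_bounds (R : realType) (nb nl ng nd : nat)
    (N : network R nb nl ng nd) (x0 : 'cV[R]_(nx N)) (u0 : 'cV[R]_(ng + ng))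
    (e : envelopes R nb nl ng) : Prop :=
  forall (x : 'cV[R]_(nx N)) (u : 'cV[R]_(ng + ng)), dispatch_point N u ->
  let g := residual x0 u0 x u in
  let v := bus_v (x_vpq x) u in
  let v_ok k := vmin N k 0 <= v k <= vmax N k 0 in
  [/\ forall i, gp_lo e i (u_pref u i 0) <= blk_p g i 0
                  <= gp_up e i (u_pref u i 0),
      forall l, let vf := v (line_from N l) in
        let vt := v (line_to N l) in let phi := x_phi x l 0 in
        v_ok (line_from N l) -> v_ok (line_to N l) ->
        phimin N l 0 <= phi <= phimax N l 0 ->
        gcos_lo e l vf vt phi <= blk_cos g l 0 <= gcos_up e l vf vt phi /\
        gsin_lo e l vf vt phi <= blk_sin g l 0 <= gsin_up e l vf vt phi &
      forall k, v_ok k ->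
        gv_lo e k (v k) <= blk_quad g k 0 <= gv_up e k (v k)].

Definition within_limits (R : realType) (nb nl ng nd : nat)
    (N : network R nb nl ng nd) (u : 'cV[R]_(ng + ng))
    (zu zl : 'cV[R]_(nz N)) : Prop :=
  (forall k, vmin N k 0 <= bus_v (z_vpq zl) u k /\
             bus_v (z_vpq zu) u k <= vmax N k 0) /\
  (forall l, phimin N l 0 <= z_phi zl l 0 /\ z_phi zu l 0 <= phimax N l 0).

Definition vertex_bounds (R : realType) (nb nl ng nd : nat)
    (N : network R nb nl ng nd) (e : envelopes R nb nl ng)
    (u : 'cV[R]_(ng + ng)) (zu zl : 'cV[R]_(nz N))
    (gu gl : 'cV[R]_(npsi nb nl ng)) : Prop :=
  let vu := bus_v (z_vpq zu) u in
  let vl := bus_v (z_vpq zl) u in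
  [/\ forall i, blk_p gl i 0 <= gp_lo e i (u_pref u i 0) /\
                gp_up e i (u_pref u i 0) <= blk_p gu i 0,
      forall l vf vt phi,
        vf \in [:: vl (line_from N l); vu (line_from N l)] ->
        vt \in [:: vl (line_to N l); vu (line_to N l)] ->
        phi \in [:: z_phi zl l 0; z_phi zu l 0] ->
        [/\ blk_cos gl l 0 <= gcos_lo e l vf vt phi,
            gcos_up e l vf vt phi <= blk_cos gu l 0,
            blk_sin gl l 0 <= gsin_lo e l vf vt phi &
            gsin_up e l vf vt phi <= blk_sin gu l 0] &
      forall k v, v \in [:: vl k; vu k] ->
        blk_quad gl k 0 <= gv_lo e k v /\ gv_up e k v <= blk_quad gu k 0].

(* Main.v *)
(* For a fixed dispatch [u], a state [x] solves the power flow equations iff it is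
   a fixed point of [x |-> - Jf^-1 (M g(x, u) + R w)].  After truncating the residual
   [g] to the interval [gl, gu], the image of this map under [A] always lies in the
   box [zl, zu], by condition (2) and the Cauchy-Schwarz inequality on the ellipsoid.
   Since [A] is injective (a direction killed by [A] does not change [psi], hence is
   killed by [Jpsi], so it vanishes as [Jf] is non-singular), this gives a continuous
   self-map of the box, and Brouwer's theorem yields a fixed point [z = A x].  On the
   box the envelopes are bounded by their values at the vertices, so there the
   truncation is inactive.

   Brouwer's theorem is deduced from a mod 2 count on the Kuhn triangulation of a
   grid.  For labels [f_j] in F_2 equal to 0 on the face [q_j = 0] and to 1 on the
   opposite one, the cup product of the coboundaries of the [f_j], summed over all
   simplices, depends only on the boundary labels (Stokes), hence equals its value 1
   for the labels [0 < q_j].  So on some simplex every [f_j] changes value. *)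
Require Import Defs.
From mathcomp Require Import all_boot all_order all_algebra all_fingroup.
From mathcomp Require Import all_classical all_reals all_analysis.
From mathcomp Require Import zify ring lra.
Import Order.TTheory GRing.Theory Num.Theory.
Import numFieldNormedType.Exports.
Set Implicit Arguments.
Unset Strict Implicit.
Unset Printing Implicit Defensive.
Local Open Scope classical_set_scope.
Local Open Scope ring_scope.

(** * A Sperner-type lemma on Kuhn's triangulation of a grid *)

Lemma addF2 (x : 'F_2) : x + x = 0.
Proof. by apply/val_inj; case: x => -[|[|k]]. Qed.

Section Char2.
Variable F : comNzRingType.
Hypothesis char2 : forall x : F, x + x = 0.

(** Right multiplication by the transposition pairs even with odd permutations, and both members of
    a pair contribute the same value, so the sum cancels mod 2. *)
Lemma sum_tperm_inv n (E : 'S_n -> F) (a b : 'I_n) : a != b ->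
  (forall s, E (s * tperm a b)%g = E s) -> \sum_s E s = 0.
Proof.
move=> ab EE; rewrite (bigID (fun s : 'S_n => odd_perm s)) /=.
rewrite (reindex_inj (mulIg (tperm a b))) /=.
under eq_bigl => s do rewrite odd_permM odd_tperm ab addbT.
under eq_bigr => s _ do rewrite EE.
exact: char2.
Qed.

Section Simplices.
Variables n m : nat.
Implicit Types (p : {ffun 'I_n.+1 -> 'I_m.+1}) (s : 'S_n.+1).
Implicit Types (q : {ffun 'I_n.+1 -> nat}).
Implicit Types f : 'I_n.+1 -> {ffun 'I_n.+1 -> nat} -> F.

(* Vertices of the Kuhn simplex of the cell [p] that increments the coordinate [i]
   at step [s i]. *)
Definition vtx p s k : {ffun 'I_n.+1 -> nat} := [ffun i => (p i + (s i < k))%N].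

(** The factor for [j] is the coboundary of [f j] on the edge from vertex [j] to vertex [j.+1], so
    the product is the value of the cup product on one simplex. *)
Definition cup_sum f :=
  \sum_s \sum_p \prod_j (f j (vtx p s j.+1) - f j (vtx p s j)).

(** The value [c] is 1 for a label and 0 for the difference of two labels. *)
Definition face_values (j : 'I_n.+1) (h : {ffun 'I_n.+1 -> nat} -> F) (c : F) :=
  (forall q, q j = 0%N -> h q = 0) /\ (forall q, q j = m.+1 -> h q = c).

(** Neither of the two exchanged increments is made up to vertex [k.-1], and both are made from
    vertex [k.+1] on, so their order shows only at vertex [k]. *)
Lemma vtx_tperm p s (k l : nat) : (0 < k <= n)%N -> l != k ->
  vtx p (s * tperm (inord k.-1) (inord k))%g l = vtx p s l.
Proof.
move=> kn lk; apply/ffunP=> i; rewrite !ffunE permM.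
congr (_ + nat_of_bool _)%N; case: tpermP => [->|->|//]; rewrite !inordK; lia.
Qed.

Section Stokes.
Variables (f : 'I_n.+1 -> {ffun 'I_n.+1 -> nat} -> F) (a : 'I_n.+1).
Variable h : {ffun 'I_n.+1 -> nat} -> F.
Hypothesis hf : forall j, j != a -> face_values j (f j) 1.
Hypothesis hh : face_values a h 0.
Implicit Types (sh : nat -> nat) (e : nat).

(** Here [f j] is differenced along the edge leaving vertex [sh j]; changing [sh] slides these edges
    along the simplex. *)
Let term (sh : nat -> nat) e p s :=
  h (vtx p s e) *
  \prod_(j | j != a) (f j (vtx p s (sh j).+1) - f j (vtx p s (sh j))).
Let total sh e := \sum_s \sum_p term sh e p s.

Lemma eq_total (sh sh' : nat -> nat) e : (forall j : 'I_n.+1, j != a -> sh j = sh' j) ->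
  total sh e = total sh' e.
Proof.
move=> E; apply: eq_bigr => s _; apply: eq_bigr => p _; congr (_ * _).
by apply: eq_bigr => j ja; rewrite E.
Qed.

(* The sum of both sides does not involve vertex [k], the only vertex affected by
   exchanging steps [k.-1] and [k]; so it vanishes mod 2. *)
Lemma total_swap sh e (j0 : 'I_n.+1) k : (0 < k <= n)%N -> j0 != a -> sh j0 = k.-1 ->
  e != k -> (forall j : 'I_n.+1, j != a -> j != j0 -> (sh j != k) && ((sh j).+1 != k))
    ->
  total sh e = total (fun j => if j == j0 then k else sh j) e.
Proof.
move=> kn ja shj ek shk.
suff: total sh e + total (fun j => if j == j0 then k else sh j) e = 0.
  by move=> H; apply/eqP;
    rewrite -subr_eq0 -[X in X - _](addrK (total (fun j => if j == j0 then k else sh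
      j) e)) H sub0r -opprD char2 oppr0.
rewrite /total -big_split /=.
under eq_bigr => s _ do rewrite -big_split /=.
rewrite exchange_big big1 //= => p _.
apply: (@sum_tperm_inv _ _ (inord k.-1) (inord k)).
  by apply/eqP => /(congr1 val); rewrite /= !inordK; lia.
have collapse s : term sh e p s + term (fun j => if j == j0 then k else sh j) e p s =
    h (vtx p s e) * ((f j0 (vtx p s k.+1) - f j0 (vtx p s k.-1)) *
     \prod_(j | (j != a) && (j != j0)) (f j (vtx p s (sh j).+1) - f j (vtx p s (sh
       j)))).
  rewrite /term (bigD1 j0) //= [X in _ + _ * X](bigD1 j0) //= eqxx shj prednK;
    last by case/andP: kn.
  rewrite [X in _ + _ * (_ * X)](eq_bigr (fun j => f j (vtx p s (sh j).+1) - f j (vtx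
    p s (sh j)))); last first.
    by move=> j /andP[_ jj]; rewrite -[_ == _]/(j == j0) (negPf jj).
  ring.
move=> s; rewrite !collapse !vtx_tperm //; try lia.
congr (_ * (_ * _)); apply: eq_bigr => j /andP[ja' jj].
by have /andP[s1 s2] := shk j ja' jj; rewrite !vtx_tperm.
Qed.

(** [shT a] and [shU a.+1] act as the identity away from [a]. At [shT 0] all edges below [a] have
    moved up, which frees vertex 0; at [shU n.+1] all edges above [a] have moved down, which frees
    vertex [n.+1]. *)
Let shT k j := if (k <= j < a)%N then j.+1 else j.
Let shU k j := if (a < j < k)%N then j.-1 else j.

(** The edge just below [a] moves first and edge 0 last. When edge [k] moves, the lower edges end at
    vertex [k] or earlier, the higher ones start at [k + 2] or later, and [h] sits at [a + 1], so
    vertex [k + 1] is free for [total_swap]. *)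
Lemma total_below k : (k <= a)%N -> total (shT k) a.+1 = total (shT 0) a.+1.
Proof.
elim: k => // k IH ka; have an := ltn_ord a; rewrite -IH; last exact: ltnW.
have kn : (k < n.+1)%N by lia.
rewrite (@total_swap _ _ (Ordinal kn) k.+1) /=; try lia.
- apply: eq_total => j _; rewrite /shT /=; case: eqP => [->|]; do ?case: ifP; lia.
- by apply/eqP => E; rewrite -E /= ltnn in ka.
- by rewrite /shT /= ltnn.
- by move=> j; rewrite -!val_eqE /= => ja jk; rewrite /shT; do ?case: ifP; lia.
Qed.

Lemma total_above k : (a < k <= n.+1)%N -> total (shU k) a = total (shU a.+1) a.
Proof.
case/andP; elim: k => // k IH; rewrite ltnS leq_eqVlt => /orP[/eqP <-//|ak] kn.
rewrite -IH //; last exact: ltnW.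
rewrite (@total_swap _ _ (Ordinal kn) k) /=; try lia.
- apply: eq_total => j _; rewrite /shU /=; case: eqP => [->|]; do ?case: ifP; lia.
- by apply/eqP => E; rewrite -E /= ltnn in ak.
- by rewrite /shU /= ak ltnSn.
- by move=> j; rewrite -!val_eqE /= => ja jk; rewrite /shU; do ?case: ifP; lia.
Qed.

(** The first step under [s] becomes the last under [s * rot], and [shift s] moves the cell along
    that step. The wrap-around of [ordS] makes [shift s] injective, so it can serve for
    reindexing. *)
Let rot : 'S_n.+1 := perm (can_inj (@ord_predK n.+1)).
Let shift s p : {ffun 'I_n.+1 -> 'I_m.+1} :=
  [ffun i => if s i == ord0 then ordS (p i) else p i].

Lemma shift_inj s : injective (shift s).
Proof.
move=> p p' /ffunP E; apply/ffunP=> i; have := E i; rewrite !ffunE.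
by case: ifP => // _ /(can_inj (@ordSK m.+1)).
Qed.

Lemma rotE s i : nat_of_ord ((s * rot)%g i) = if s i == ord0 then n else (s i).-1.
Proof.
rewrite permM permE /=; have := ltn_ord (s i); case: eqP => [->|/eqP H] /= L.
  by rewrite modn_small.
have s0 : (0 < s i)%N by rewrite lt0n.
by rewrite -{1}(prednK s0) addSn /= modnDr modn_small //; lia.
Qed.

Lemma term0 sh e p s b : 
  (b = a -> h (vtx p s e) = 0) ->
  (b != a -> f b (vtx p s (sh b).+1) = f b (vtx p s (sh b))) -> term sh e p s = 0.
Proof.
have [-> H _|ba _ H] := eqVneq b a; first by rewrite /term H // mul0r.
by rewrite /term (bigD1 b) //= H // subrr mul0r mulr0.
Qed.

(* The face without vertex 0 of a simplex is the face without vertex [n.+1] of a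
   simplex in the next cell.  Cells are taken cyclically: where this wraps around,
   both terms vanish by the boundary conditions. *)
Lemma total_rot : total (shT 0) a.+1 = total (shU n.+1) a.
Proof.
rewrite [RHS](reindex_inj (mulIg rot)) /=; apply: eq_bigr => s _.
rewrite [RHS](reindex_inj (@shift_inj s)); apply: eq_bigr => p _.
pose b := (s^-1)%g ord0; have sb : s b = ord0 by rewrite permKV.
have sbE i : (s i == ord0) = (i == b) by rewrite -sb (inj_eq perm_inj).
have an := ltn_ord a.
(* The first step increments coordinate [b]. If it reaches [m.+1], all later vertices lie on that
   face, and the wrapped simplex has all vertices but its last on the face 0. On either face [h]
   vanishes if [b = a], and [f b] is constant otherwise. *)
have [pb|pb] := eqVneq (p b : nat) m.
  have L k : (0 < k)%N -> vtx p s k b = m.+1.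
    by move=> k0; rewrite ffunE sb k0 pb addn1.
  have U k : (k <= n)%N -> vtx (shift s p) (s * rot)%g k b = 0%N.
    by move=> kn; rewrite !ffunE rotE sb eqxx /= ltnNge kn addn0 pb modnn.
  rewrite (@term0 (shT 0) _ _ _ b); first last.
  - move=> ba; case: (hf ba) => _ h1; have := ltn_ord b; move: ba;
      rewrite -val_eqE /= => ba bn.
    by rewrite !h1 // L // /shT; do ?case: ifP; lia.
  - by move=> ba; case: hh => _ h1; apply: h1; rewrite -[in LHS]ba L.
  rewrite (@term0 (shU n.+1) _ _ _ b) //.
  - by move=> ba; case: hh => h0 _; apply: h0; rewrite -{2}ba U //; lia.
  - move=> ba; case: (hf ba) => h0 _; have := ltn_ord b; move: ba;
      rewrite -val_eqE /= => ba bn.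
    by rewrite !h0 // U // /shU; do ?case: ifP; lia.
have V k : (k <= n)%N -> vtx (shift s p) (s * rot)%g k = vtx p s k.+1.
  move=> kn; apply/ffunP => i; rewrite !ffunE rotE.
  case: ifPn => [|si].
    rewrite sbE => /eqP ->; rewrite sb /= modn_small;
      last by rewrite ltnS ltn_neqAle pb -ltnS ltn_ord.
    by lia.
  have : (0 < s i)%N by rewrite lt0n.
  by lia.
rewrite /term V; last by lia.
congr (_ * _); apply: eq_bigr => j ja; have := ltn_ord j; move: ja;
  rewrite -val_eqE /= => ja jn.
have E : shT 0 j = (shU n.+1 j).+1 by rewrite /shT /shU; do ?case: ifP; lia.
by rewrite E !V //; rewrite /shU; do ?case: ifP; lia.
Qed.

(** The part with [h] at vertex [a.+1] slides to the face without vertex 0, the part with [h] at [a]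
    to the face without vertex [n.+1], and [total_rot] identifies the two. *)
Lemma stokes :
  \sum_s \sum_p (h (vtx p s a.+1) - h (vtx p s a)) *
     \prod_(j | j != a) (f j (vtx p s j.+1) - f j (vtx p s j)) = 0.
Proof.
have E : total id a.+1 = total id a.
  rewrite (@eq_total id (shT a)); last by move=> j _; rewrite /shT; do ?case: ifP; lia.
  rewrite total_below // total_rot total_above ?ltn_ord ?leqnn //.
  by apply: eq_total => j _; rewrite /shU; do ?case: ifP; lia.
transitivity (total id a.+1 - total id a); last by rewrite E subrr.
rewrite /total -sumrB; apply: eq_bigr => s _.
by rewrite -sumrB; apply: eq_bigr => p _; rewrite /term mulrBl.
Qed.
End Stokes.

(** The cup product is linear in its factor [a], and [f a - f' a] vanishes on both faces of
    direction [a], so the difference of the two sums is covered by [stokes]. *)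
Lemma cup_sum_replace f f' (a : 'I_n.+1) :
  (forall j, face_values j (f j) 1) -> (forall j, face_values j (f' j) 1) ->
  (forall j, j != a -> f j = f' j) -> cup_sum f = cup_sum f'.
Proof.
move=> hf hf' ff; apply/eqP; rewrite -subr_eq0; apply/eqP.
rewrite -(@stokes f a (fun q => f a q - f' a q)) //; last first.
  case: (hf a) (hf' a) => [f0 f1] [f0' f1'].
  by split => q qa; [rewrite f0 // f0' // subrr|rewrite f1 // f1' // subrr].
rewrite /cup_sum -sumrB; apply: eq_bigr => s _; rewrite -sumrB; apply: eq_bigr => p _.
rewrite (bigD1 a) //= [X in _ - X](bigD1 a) //=.
rewrite [X in _ - _ * X](eq_bigr (fun j => f j (vtx p s j.+1) - f j (vtx p s j)));
  last first.
  by move=> j ja; rewrite ff.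
ring.
Qed.

Let std (j : 'I_n.+1) (q : {ffun 'I_n.+1 -> nat}) : F := (0 < q j)%N%:R.

(** The label [std j] changes along edge [j] exactly when [p j = 0] and [s j = j], so only the
    identity permutation in the cell at the origin contributes. *)
Lemma cup_sum_std : cup_sum std = 1.
Proof.
have stdE p s (j : 'I_n.+1) : std j (vtx p s j.+1) - std j (vtx p s j) =
    ((p j == ord0) && (s j == j))%:R.
  rewrite /std !ffunE -!val_eqE /=.
  have -> : (0 < p j + (s j < j.+1))%N = ~~ ((p j == 0 :> nat) && (j < s j)%N) by lia.
  have -> : (0 < p j + (s j < j))%N = ~~ ((p j == 0 :> nat) && (j <= s j)%N) by lia.
  by case: (p j == 0 :> nat); case: ltngtP => //= _; rewrite ?subrr ?subr0.
rewrite /cup_sum (bigD1 1%g) //= (bigD1 [ffun=> ord0]) //= big1 => [|j _]; last first.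
  by rewrite stdE ffunE perm1 !eqxx.
rewrite big1 ?addr0 => [|p]; last first.
  move=> p0; have [j pj] : exists j, p j != ord0.
    apply/existsP; apply: contraR p0 => /existsPn H; apply/eqP/ffunP => j.
    by rewrite ffunE; apply/eqP; have := H j; rewrite negbK.
  by rewrite (bigD1 j) //= stdE (negPf pj) mul0r.
rewrite big1 ?addr0 // => s s1; rewrite big1 // => p _.
have [j sj] : exists j, s j != j.
  apply/existsP; apply: contraR s1 => /existsPn H; apply/eqP/permP => j.
  by rewrite perm1; apply/eqP; have := H j; rewrite negbK.
by rewrite (bigD1 j) //= stdE (negPf sj) andbF mul0r.
Qed.

(** The labels are exchanged for the standard ones one direction at a time. *)
Lemma cup_sum1 f : (forall j, face_values j (f j) 1) -> cup_sum f = 1.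
Proof.
move=> hf; pose g k (j : 'I_n.+1) := if (j < k)%N then std j else f j.
have hg k j : face_values j (g k j) 1.
  by rewrite /g; case: ifP => _ //; split => q qj; rewrite /std qj.
have step k : (k <= n.+1)%N -> cup_sum f = cup_sum (g k).
  elim: k => // k IH kn; rewrite IH ?(ltnW kn) //.
  apply: (@cup_sum_replace _ _ (Ordinal kn)) => // j; rewrite -val_eqE /= => jk.
  by rewrite /g; have -> : (j < k.+1)%N = (j < k)%N by lia.
rewrite (step n.+1) // -cup_sum_std; apply: eq_bigr => s _; apply: eq_bigr => p _.
by apply: eq_bigr => j _; rewrite /g ltn_ord.
Qed.

End Simplices.
End Char2.

Lemma rainbow_simplex n (m : nat) (f : 'I_n.+1 -> {ffun 'I_n.+1 -> nat} -> bool) :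
  (forall j (q : {ffun 'I_n.+1 -> nat}), q j = 0%N -> f j q = false) -> (forall j (q :
    {ffun 'I_n.+1 -> nat}), q j = m.+1 -> f j q = true) ->
  exists (p : {ffun 'I_n.+1 -> 'I_m.+1}) s, forall j, f j (vtx p s j.+1) != f j (vtx p
    s j).
Proof.
move=> f0 f1; pose F j (q : {ffun 'I_n.+1 -> nat}) : 'F_2 := (f j q)%:R.
have : cup_sum m F = 1.
  by apply: (cup_sum1 addF2) => j; split => q qj; rewrite /F ?(f0 j q qj) ?(f1 j q qj).
move=> S1.
have [s Hs] : exists s : 'S_n.+1, \sum_(p : {ffun 'I_n.+1 -> 'I_m.+1}) \prod_j (F j
  (vtx p s j.+1) - F j (vtx p s j)) != 0.
  apply/existsP; apply: contraT => /existsPn H; have := oner_neq0 'F_2;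
    rewrite -S1 /cup_sum.
  by rewrite big1 ?eqxx // => s _; apply/eqP; have := H s; rewrite negbK.
have [p Hp] : exists p : {ffun 'I_n.+1 -> 'I_m.+1}, \prod_j (F j (vtx p s j.+1) - F j
  (vtx p s j)) != 0.
  apply/existsP; apply: contraR Hs => /existsPn H.
  by rewrite big1 // => p _; apply/eqP; have := H p; rewrite negbK.
exists p, s => j; move/prodf_neq0: Hp => /(_ j isT).
by apply: contra => /eqP E; rewrite /F E subrr.
Qed.

(** * The theorems of Poincare-Miranda and Brouwer *)

Definition unit_cube (R : realType) n : set 'rV[R]_n :=
  [set x : 'rV[R]_n | forall i, 0 <= x 0 i <= 1].

Lemma compact_unit_cube (R : realType) n : compact (@unit_cube R n).
Proof.
have := @rV_compact R n (fun=> `[0, 1]%classic) (fun=> @segment_compact _ _ _).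
congr compact; apply/seteqP; split=> x /= H i; have := H i; rewrite ?in_itv //= ?inE.
Qed.

Section PoincareMiranda.
Variables (R : realType) (n : nat).
Implicit Types x y : 'rV[R]_n.

Variable F : 'I_n -> 'rV[R]_n -> R.
Hypothesis F0 : forall j x, unit_cube x -> x 0 j = 0 -> F j x <= 0.
Hypothesis F1 : forall j x, unit_cube x -> x 0 j = 1 -> 0 <= F j x.

Lemma approximate_zero (m : nat) : exists2 x, unit_cube x &
  forall j, exists y y', [/\ forall i, `|x 0 i - y 0 i| <= m.+1%:R^-1,
    forall i, `|x 0 i - y' 0 i| <= m.+1%:R^-1, F j y <= 0 & 0 <= F j y'].
Proof.
case: n F F0 F1 => [|k] G G0 G1; first by exists 0 => [] [].
pose M : R := m.+1%:R; have M0 : 0 < M by rewrite ltr0n.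
pose pt (q : {ffun 'I_k.+1 -> nat}) : 'rV[R]_k.+1 := \row_i ((q i)%:R / M).
(* The sign hypotheses on opposite faces are only weak, so the label is forced there instead of
   being read off from [G j]. Every label still determines a weak sign of [G j]. *)
pose f (j : 'I_k.+1) (q : {ffun 'I_k.+1 -> nat}) :=
  (0 < q j)%N && ((q j == m.+1) || (0 < G j (pt q))).
have [||p [s ps]] := @rainbow_simplex k m f.
- by move=> j q qj; rewrite /f qj.
- by move=> j q qj; rewrite /f qj eqxx.
have cube l (i : 'I_k.+1) : 0 <= pt (vtx p s l) 0 i <= 1.
  rewrite mxE ffunE divr_ge0 ?ler0n ?(ltW M0) //= ler_pdivrMr // mul1r ler_nat.
  by have := ltn_ord (p i); case: (s i < l)%N; lia.
have sgn j l : if f j (vtx p s l) then 0 <= G j (pt (vtx p s l)) else G j (pt (vtx p s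
  l)) <= 0.
  rewrite /f; case: (posnP (vtx p s l j)) => [v0|v0] /=.
    by apply: G0; [exact: cube | rewrite mxE v0 mul0r].
  case: eqP => [v1|_] /=; last by case: ltP => // /ltW.
  by apply: G1; [exact: cube | rewrite mxE v1 divff // gt_eqF].
have close l (i : 'I_k.+1) : `|pt (vtx p s 0) 0 i - pt (vtx p s l) 0 i| <= M^-1.
  rewrite !mxE -mulrBl normrM (gtr0_norm (x := M^-1)) ?invr_gt0 //.
  rewrite ler_piMl ?invr_ge0 ?(ltW M0) // !ffunE !ltn0 addn0 natrD opprD addNKr.
  by case: (_ < _)%N; rewrite normrN ?normr1 ?normr0 ?ler01.
exists (pt (vtx p s 0)) => [i|j]; first exact: cube.
have := ps j; have := sgn j j.+1; have := sgn j j.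
case: (f j (vtx p s j)); case: (f j (vtx p s j.+1)) => // s1 s2 _.
- by exists (pt (vtx p s j.+1)), (pt (vtx p s j)).
- by exists (pt (vtx p s j)), (pt (vtx p s j.+1)).
Qed.

(** The zero is a cluster point of the approximate zeros. In each of its neighbourhoods every [F j]
    takes both weak signs, so by continuity [F j] has no strict sign at the point itself. *)
Theorem poincare_miranda : (forall j, continuous (F j)) ->
  exists2 x, unit_cube x & forall j, F j x = 0.
Proof.
move=> cF; pose X m := projT1 (cid2 (approximate_zero m)).
have XP m : unit_cube (X m) /\ forall j, exists y y', [/\ forall i, `|X m 0 i - y 0 i|
  <= m.+1%:R^-1,
    forall i, `|X m 0 i - y' 0 i| <= m.+1%:R^-1, F j y <= 0 & 0 <= F j y'].
  by rewrite /X; case: cid2.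
have [|x [cx clx]] := compact_unit_cube (F := X @ \oo) _.
  by exists 0%N => // m _; exact: (XP m).1.
exists x => // j.
have key (P : set 'rV[R]_n) : nbhs x P -> exists y y', [/\ P y, P y', F j y <= 0 & 0
  <= F j y'].
  move=> /nbhs_ballP [e /= e0 eP].
  have e2 : 0 < e / 2 by rewrite divr_gt0.
  pose Q (z : 'rV[R]_n) := exists y y', [/\ forall i, `|z 0 i - y 0 i| < e / 2,
     forall i, `|z 0 i - y' 0 i| < e / 2, F j y <= 0 & 0 <= F j y'].
  have near_m : \forall m \near \oo, Q (X m).
    near=> m; have [y [y' [h1 h2 h3 h4]]] := (XP m).2 j.
    have small : m.+1%:R^-1 < e / 2.
      near: m; exact: (near_infty_natSinv_lt (PosNum e2)).
    by exists y, y'; split => // i;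
      [apply: le_lt_trans (h1 i) _|apply: le_lt_trans (h2 i) _].
  have [z [/= [y [y' [h1 h2 h3 h4]]] xz]] := clx _ _ near_m (nbhsx_ballx x _ e2).
  have tri (t : 'rV[R]_n) : (forall i, `|z 0 i - t 0 i| < e / 2) -> ball x e t.
    move=> zt; split=> // i l; rewrite (ord1 i) [e]splitr.
    apply: (@ball_triangle _ _ (z 0 l)); first by case: xz => _; apply.
    exact: zt.
  by exists y, y'; split => //; apply/eP/tri.
apply/eqP; rewrite eq_le; apply/andP; split; rewrite leNgt; apply/negP => Fx.
- have [|y [y' [h _ hy _]]] := key (fun y => 0 < F j y); last by rewrite ltNge hy in h.
  exact: (cvgr_gt _ (cF j x)) Fx.
- have [|y [y' [_ h _ hy]]] := key (fun y => F j y < 0); last by rewrite ltNge hy in h.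
  exact: (cvgr_lt _ (cF j x)) Fx.
Unshelve. all: by end_near.
Qed.
End PoincareMiranda.

(** * Continuity of real-valued functions, and the passage from the cube to a box *)

Section RealValued.
Variables (R : realType) (T : topologicalType).
Implicit Types f g : T -> R.

Lemma continuous_cst (c : R) : continuous (fun _ : T => c).
Proof. by move=> x; apply: cvg_cst. Qed.

Lemma continuous_add f g : continuous f -> continuous g -> continuous (fun x => f x +
  g x).
Proof. by move=> cf cg x; apply: cvgD; [exact: cf|exact: cg]. Qed.

Lemma continuous_mul f g : continuous f -> continuous g -> continuous (fun x => f x *
  g x).
Proof. by move=> cf cg x; apply: cvgM; [exact: cf|exact: cg]. Qed.

Lemma continuous_sum (I : finType) (h : I -> T -> R) :
  (forall i, continuous (h i)) -> continuous (fun x => \sum_i h i x).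
Proof.
move=> ch; suff H (r : seq I) : continuous (fun x => \sum_(i <- r) h i x) by exact: H.
elim: r => [|i r IH].
  under [fun x => _]funext => x do rewrite big_nil.
  exact: continuous_cst.
under [fun x => _]funext => x do rewrite big_cons.
exact: continuous_add.
Qed.

Lemma continuous_clip (a b : R) f : continuous f ->
  continuous (fun x => Num.max a (Num.min b (f x))).
Proof.
move=> cf x; apply: (@continuous_max R T (fun=> a) (fun x => Num.min b (f x))).
  exact: continuous_cst.
by apply: (@continuous_min R T (fun=> b) f); [exact: continuous_cst|exact: cf].
Qed.
End RealValued.

Lemma continuous_mx (R : realType) (T : topologicalType) m n (f : T -> 'M[R]_(m, n)) :
  (forall i j, continuous (fun x => f x i j)) -> continuous f.
Proof.
move=> cf x; apply/cvg_ballP => e e0.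
have : \forall y \near x, forall i j, ball (f x i j) e (f y i j).
  apply: filter_forall => i; apply: filter_forall => j.
  by move: (cf i j x) => /cvg_ballP; exact.
by apply: filterS => y.
Qed.

(** The Poincare-Miranda theorem is applied to [z - H z]: as [H] stays in the box, this difference
    has the right sign on each face. The parametrisation [Z] need not be injective, so sides of
    length 0 are allowed. *)
Theorem brouwer_box (R : realType) n (a b : 'cV[R]_n) (H : 'cV[R]_n -> 'cV[R]_n) :
  lev a b -> (forall i, continuous (fun z => H z i 0)) ->
  (forall z, lev a z -> lev z b -> lev a (H z) /\ lev (H z) b) ->
  exists z, [/\ lev a z, lev z b & H z = z].
Proof.
move=> ab cH Hbox.
pose Z (t : 'rV[R]_n) : 'cV[R]_n := \col_i (a i 0 + t 0 i * (b i 0 - a i 0)).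
have Zbox t : unit_cube t -> lev a (Z t) /\ lev (Z t) b.
  move=> ct; split=> i; rewrite mxE; have := ab i; have /andP[] := ct i; nra.
have cZ : continuous Z.
  apply: continuous_mx => i j; rewrite (ord1 j).
  rewrite (_ : (fun x => Z x i 0) = fun x => a i 0 + x 0 i * (b i 0 - a i 0));
    last by apply/funext => ?; rewrite mxE.
  apply: continuous_add; first exact: continuous_cst.
  by apply: continuous_mul; [exact: coord_continuous|exact: continuous_cst].
have [||j|t ct Ft] := @poincare_miranda R n (fun j t => Z t j 0 - H (Z t) j 0).
- move=> j t ct tj; have [h _] := Hbox _ (Zbox t ct).1 (Zbox t ct).2.
  by have := h j; rewrite mxE tj; lra.
- move=> j t ct tj; have [_ h] := Hbox _ (Zbox t ct).1 (Zbox t ct).2.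
  by have := h j; rewrite mxE tj; lra.
- have cHj : continuous (fun t => - H (Z t) j 0).
    move=> t; apply: continuousN;
      apply: (@continuous_comp _ _ _ Z (fun z : 'cV[R]_n => H z j 0)).
      exact: cZ.
    exact: cH.
  apply: continuous_add => // t.
  by apply: (@continuous_comp _ _ _ Z (fun z : 'cV[R]_n => z j 0));
    [exact: cZ|exact: coord_continuous].
exists (Z t); have [h1 h2] := Zbox t ct; split => //.
apply/colP => i; have := Ft i; lra.
Qed.

(** * Convexity and linear algebra *)

Section Convexity.
Variable R : realType.

Lemma convex_functionP (E : lmodType R) (f : E -> R) (t : R) (x y : E) :
  @convex_function R E setT f -> 0 <= t <= 1 ->
  f (t *: x + (1 - t) *: y) <= t * f x + (1 - t) * f y.
Proof.
move=> cf /andP[t0 t1].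
have := cf (Itv01 t0 t1) x y; rewrite !inE => /(_ I I).
by [].
Qed.

Lemma le_segment (f : R -> R) (a b x c : R) :
  (forall t, 0 <= t <= 1 -> f (t * a + (1 - t) * b) <= t * f a + (1 - t) * f b) ->
  a <= x <= b -> f a <= c -> f b <= c -> f x <= c.
Proof.
move=> cf /andP[ax xb] fa fb; have [ab|ab] := eqVneq a b.
  by have -> : x = a by lra.
have ba : 0 < b - a by have := le_trans ax xb; rewrite le_eqVlt (negPf ab) /= subr_gt0.
pose t := (b - x) / (b - a).
have t01 : 0 <= t <= 1.
  by rewrite /t divr_ge0 ?(ltW ba) ?subr_ge0 //= ler_pdivrMr // mul1r lerD2l lerN2.
have -> : x = t * a + (1 - t) * b.
  by rewrite /t; field; rewrite gt_eqF.
apply: le_trans (cf _ t01) _; have /andP[t0 t1] := t01; nra.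
Qed.

Lemma convex1_le (f : R -> R) a b x c : convex1 f -> a <= x <= b ->
  (forall y, y \in [:: a; b] -> f y <= c) -> f x <= c.
Proof.
move=> cf axb fc; apply: (le_segment _ axb); try by apply: fc; rewrite !inE eqxx ?orbT.
by move=> t t01; exact: (@convex_functionP R^o f t a b cf t01).
Qed.

(** The bound spreads from vertices to edges, faces and the whole box. Each stage varies one
    coordinate, and [self] shows that the others stay fixed under the convex combination. *)
Lemma convex3_le (f : R -> R -> R -> R) a1 b1 x1 a2 b2 x2 a3 b3 x3 c : convex3 f ->
  a1 <= x1 <= b1 -> a2 <= x2 <= b2 -> a3 <= x3 <= b3 ->
  (forall y1 y2 y3, y1 \in [:: a1; b1] -> y2 \in [:: a2; b2] -> y3 \in [:: a3; b3] ->
     f y1 y2 y3 <= c) -> f x1 x2 x3 <= c.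
Proof.
move=> cf h1 h2 h3 fc.
have conv t (p q : R^o * R^o * R^o) := @convex_functionP _ (fun a => f a.1.1 a.1.2
  a.2) t p q cf.
have self (t y : R) : t * y + (1 - t) * y = y by ring.
have ends (a b : R) : a \in [:: a; b] /\ b \in [:: a; b] by rewrite !inE !eqxx orbT.
have s1 y2 y3 : y2 \in [:: a2; b2] -> y3 \in [:: a3; b3] -> f x1 y2 y3 <= c.
  move=> h2' h3'; apply: (@le_segment (fun y => f y y2 y3) _ _ _ _ _ h1).
  - by move=> t t01; have := conv t (a1, y2, y3) (b1, y2, y3) t01; rewrite /= !self.
  - by apply: fc => //; case: (ends a1 b1).
  - by apply: fc => //; case: (ends a1 b1).
have s2 y3 : y3 \in [:: a3; b3] -> f x1 x2 y3 <= c.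
  move=> h3'; apply: (@le_segment (fun y => f x1 y y3) _ _ _ _ _ h2).
  - by move=> t t01; have := conv t (x1, a2, y3) (x1, b2, y3) t01; rewrite /= !self.
  - by apply: s1 => //; case: (ends a2 b2).
  - by apply: s1 => //; case: (ends a2 b2).
apply: (@le_segment (fun y => f x1 x2 y) _ _ _ _ _ h3).
- by move=> t t01; have := conv t (x1, x2, a3) (x1, x2, b3) t01; rewrite /= !self.
- by apply: s2; case: (ends a3 b3).
- by apply: s2; case: (ends a3 b3).
Qed.

Lemma concave1_ge (f : R -> R) a b x c : concave1 f -> a <= x <= b ->
  (forall y, y \in [:: a; b] -> c <= f y) -> c <= f x.
Proof.
move=> cf axb fc; rewrite -lerN2;
  apply: (@convex1_le (fun y => - f y) a b x (- c) cf axb) => y /fc.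
by rewrite lerN2.
Qed.

Lemma concave3_ge (f : R -> R -> R -> R) a1 b1 x1 a2 b2 x2 a3 b3 x3 c : concave3 f ->
  a1 <= x1 <= b1 -> a2 <= x2 <= b2 -> a3 <= x3 <= b3 ->
  (forall y1 y2 y3, y1 \in [:: a1; b1] -> y2 \in [:: a2; b2] -> y3 \in [:: a3; b3] ->
     c <= f y1 y2 y3) -> c <= f x1 x2 x3.
Proof.
move=> cf h1 h2 h3 fc; rewrite -lerN2;
  apply: (@convex3_le (fun y1 y2 y3 => - f y1 y2 y3) _ _ _ _ _ _ _ _ _ (- c) cf h1 h2
    h3) => y1 y2 y3 k1 k2 k3.
by rewrite lerN2 fc.
Qed.
End Convexity.

(** * Cauchy-Schwarz, ellipsoids and interval bounds for matrix products *)

Section Linear.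
Variable R : realType.

Lemma cauchy_schwarz_le n (a : 'rV[R]_n) (y : 'cV[R]_n) (gamma : R) :
  0 <= gamma -> (y^T *m y) 0 0 <= gamma ^+ 2 ->
  `|(a *m y) 0 0| <= gamma * norm2 a.
Proof.
move=> g0; rewrite !mxE; set s := \sum_j a 0 j * y j 0.
have -> : \sum_j y^T 0 j * y j 0 = \sum_j y j 0 ^+ 2 by apply: eq_bigr => j _;
  rewrite mxE.
set Y := \sum_j _ => hY.
pose n2 := \sum_j a 0 j ^+ 2; have n20 : 0 <= n2 by apply: sumr_ge0 => j _;
  exact: sqr_ge0.
have sn : norm2 a ^+ 2 = n2 by rewrite sqr_sqrtr.
have nn0 : 0 <= norm2 a by exact: sqrtr_ge0.
have key : s ^+ 2 <= n2 * Y.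
  have [n0|n0] := eqVneq n2 0.
    rewrite n0 mul0r; suff -> : s = 0 by rewrite expr0n.
    apply: big1 => j _; suff -> : a 0 j = 0 by rewrite mul0r.
    move/eqP: n0; rewrite psumr_eq0 => [|i _]; last exact: sqr_ge0.
    by move=> /allP/(_ j (mem_index_enum _)) /=; rewrite sqrf_eq0 => /eqP.
  (* This is the squared norm of [y] made orthogonal to [a], scaled by [n2] to avoid a division. *)
  have : 0 <= \sum_j (n2 * y j 0 - s * a 0 j) ^+ 2 by apply: sumr_ge0 => j _;
    exact: sqr_ge0.
  have -> : \sum_j (n2 * y j 0 - s * a 0 j) ^+ 2 = n2 * (n2 * Y - s ^+ 2).
    have sq (c d : R) : \sum_j (c * y j 0 - d * a 0 j) ^+ 2 =
        c ^+ 2 * (\sum_j y j 0 ^+ 2) - 2 * c * d * (\sum_j a 0 j * y j 0) + d ^+ 2 *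
          (\sum_j a 0 j ^+ 2).
      by rewrite !mulr_sumr -sumrB -big_split /=; apply: eq_bigr => j _; ring.
    by rewrite sq -/s -/n2 -/Y; ring.
  by rewrite pmulr_rge0 ?subr_ge0 // lt_def n0.
rewrite -(ler_pXn2r (n := 2)) ?nnegrE ?mulr_ge0 //.
rewrite real_normK ?num_real // exprMn sn mulrC.
by apply: le_trans key _; rewrite ler_wpM2l.
Qed.

(** Substituting [w - w0 = L *m y] turns the quadratic form into [y^T *m y], so the ellipsoid
    becomes a ball of radius [gamma]. *)
Lemma ellipsoid_le n (S L : 'M[R]_n) (w0 w : 'cV[R]_n) (a : 'rV[R]_n) gamma :
  cholesky_factor S L -> 0 <= gamma -> uncertainty_set w0 S gamma w ->
  `|(a *m (w - w0)) 0 0| <= gamma * norm2 (a *m L).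
Proof.
move=> [trigL posL ->] g0; rewrite /uncertainty_set /= => hw.
have Lu : L \in unitmx.
  by rewrite unitmxE det_trig // unitfE; apply/prodf_neq0 => i _; rewrite gt_eqF.
have LTu : L^T \in unitmx by rewrite unitmx_tr.
have [y wE] : exists y, w - w0 = L *m y by exists (invmx L *m (w - w0));
  rewrite mulKVmx.
rewrite wE mulmxA; apply: cauchy_schwarz_le => //.
apply: le_trans hw; rewrite le_eqVlt; apply/orP; left; apply/eqP; congr (_ _ 0 0).
have LLu : L *m L^T \in unitmx by rewrite unitmx_mul Lu.
have Ey : L *m y = (L *m L^T) *m (invmx L^T *m y) by rewrite -mulmxA (mulKVmx LTu).
by rewrite wE -mulmxA {2}Ey (mulKmx LLu) trmx_mul -mulmxA (mulKVmx LTu).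
Qed.

(** With [m] and [n] variables the equation can be eliminated; this is not possible for [neq_nx],
    whose sides are compound. *)
Lemma castmx_inv m n (e : m = n) (J : 'M[R]_(m, n)) :
  castmx (e, erefl n) J \in unitmx ->
  let Ji := castmx (erefl n, esym e) (invmx (castmx (e, erefl n) J)) in
  J *m Ji = 1%:M /\ Ji *m J = 1%:M.
Proof.
by move: J; case: n / e => J; rewrite !castmx_id => Ju; rewrite /= mulmxV // mulVmx.
Qed.

Lemma interval_mulmx_le m n (K : 'M[R]_(m, n)) (gl gu c : 'cV[R]_n) :
  lev gl c -> lev c gu ->
  lev (K *m c) (pos_part K *m gu + neg_part K *m gl) /\
  lev (pos_part K *m gl + neg_part K *m gu) (K *m c).
Proof.
move=> hl hu; split=> i; rewrite !mxE -big_split /=; apply: ler_sum => j _;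
  rewrite !mxE;
  have := hl j; have := hu j; case: (leP (K i j) 0) => k; nra.
Qed.

End Linear.

(** * The power flow map *)

(** By differentiability the sum is the derivative in direction [d], along which [f] is constant. *)
Lemma derive_differentiable_eq0 (R : realType) n (f : 'cV[R]_n -> R^o) (x d :
  'cV[R]_n) :
  differentiable f x -> (forall t : R, f (t *: d + x) = f x) ->
  \sum_j 'D_(delta_mx j 0 : 'cV[R]_n) f x * d j 0 = 0.
Proof.
move=> df fc.
have -> : \sum_j 'D_(delta_mx j 0 : 'cV[R]_n) f x * d j 0 = 'D_d f x.
  rewrite (deriveE _ df).
  have {2}-> : d = \sum_j d j 0 *: (delta_mx j 0 : 'cV[R]_n).
    apply/colP => i; rewrite summxE (bigD1 i) //= !mxE !eqxx mulr1 big1 ?addr0 // => j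
      ji.
    by rewrite !mxE eq_sym (negPf ji) mulr0.
  rewrite linear_sum; apply: eq_bigr => j _.
  by rewrite (deriveE _ df) linearZ /= mulrC.
rewrite /derive (_ : (fun _ => _) = cst 0); first exact: lim_cst.
by apply/funext => t /=; rewrite fc subrr scaler0.
Qed.

Section Network.
Variables (R : realType) (nb nl ng nd : nat) (N : network R nb nl ng nd).
Implicit Types (x d : 'cV[R]_(nx N)) (u : 'cV[R]_(ng + ng)).

Lemma Amx_mulE x : Amx N *m x = col_mx (x_phi x) (dsubmx x).
Proof.
rewrite /Amx -{1}(vsubmxK x) mul_block_col !mul0mx addr0 add0r.
by rewrite -scalar_mx_block mul1mx.
Qed.

Lemma psi_Amx x y u : Amx N *m x = Amx N *m y -> psi x u = psi y u.
Proof.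
by rewrite !Amx_mulE => /eq_col_mx [E1 E2]; rewrite /psi /x_vpq /x_Delta E1 E2.
Qed.

Lemma bus_v_cases u (k : 'I_nb) : (exists c, forall vpq : 'cV[R]_(npq N), bus_v vpq u
  k = c) \/
  exists j, forall vpq : 'cV[R]_(npq N), bus_v vpq u k = vpq j 0.
Proof.
rewrite /bus_v; case: pickP => [i _|_]; first by left; exists (u_vg u i 0).
by case: pickP => [j _|_]; [right; exists j|left; exists 0].
Qed.

Lemma differentiable_bus_v u k x :
  differentiable (fun y : 'cV[R]_(nx N) => bus_v (x_vpq y) u k : R^o) x.
Proof.
case: (bus_v_cases u k) => [[c E]|[j E]].
  rewrite (_ : (fun _ => _) = cst c); first exact: differentiable_cst.
  by apply/funext => y; rewrite E.
rewrite (_ : (fun _ => _) = fun y : 'cV[R]_(nx N) => y (rshift _ (lshift _ j)) 0);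
  first exact: differentiable_coord.
by apply/funext => y; rewrite E !mxE.
Qed.

Lemma differentiable_x_phi l x :
  differentiable (fun y : 'cV[R]_(nx N) => x_phi y l 0 : R^o) x.
Proof.
rewrite (_ : (fun _ => _) = \sum_j (fun y : 'cV[R]_(nx N) =>
    ((ns_rows N (incidence N))^T l j *: y (lshift _ j) 0 : R^o))).
  apply: differentiable_sum => j; apply: differentiableZ; exact: differentiable_coord.
by apply/funext => y; rewrite /x_phi mxE fct_sumE; apply: eq_bigr => j _; rewrite !mxE.
Qed.

(** [Jpsi] only records partial derivatives; differentiability makes its product with a vector a
    directional derivative, and also gives continuity. *)
Lemma differentiable_psi u i x : differentiable (fun y : 'cV[R]_(nx N) => psi y u i 0
  : R^o) x.
Proof.
have diff_cos (a : R) : differentiable (cos : R -> R^o) a by apply/derivable1_diffP;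
  exact: derivable_cos.
have diff_sin (a : R) : differentiable (sin : R -> R^o) a by apply/derivable1_diffP;
  exact: derivable_sin.
case: (split_ordP i) => {}i ->.
  under [fun y => _]funext => y do rewrite col_mxEu mxE.
  apply: differentiableD; first exact: differentiable_cst.
  apply: differentiableZ.
  rewrite (_ : @x_Delta R nb nl ng nd N = fun y : 'cV[R]_(nx N) => y (rshift _ (rshift
    _ 0)) 0); first exact: differentiable_coord.
  by apply/funext => y; rewrite /x_Delta !mxE.
case: (split_ordP i) => {}i ->.
  under [fun y => _]funext => y do rewrite col_mxEd col_mxEu mxE.
  apply: differentiableM.
    by apply: differentiableM; exact: differentiable_bus_v.
  apply: (@differentiable_comp _ _ R^o R^o (fun y : 'cV[R]_(nx N) => x_phi y i 0) cos).
    exact: differentiable_x_phi.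
  exact: diff_cos.
case: (split_ordP i) => {}i ->.
  under [fun y => _]funext => y do rewrite col_mxEd col_mxEd col_mxEu mxE.
  apply: differentiableM.
    by apply: differentiableM; exact: differentiable_bus_v.
  apply: (@differentiable_comp _ _ R^o R^o (fun y : 'cV[R]_(nx N) => x_phi y i 0) sin).
    exact: differentiable_x_phi.
  exact: diff_sin.
under [fun y => _]funext => y do rewrite col_mxEd col_mxEd col_mxEd mxE expr2.
by apply: differentiableM; exact: differentiable_bus_v.
Qed.

Lemma continuous_psi u i : continuous (fun y : 'cV[R]_(nx N) => psi y u i 0).
Proof. move=> x; exact: (differentiable_continuous (differentiable_psi u i x)). Qed.

Lemma Jpsi_ker x0 u0 d : Amx N *m d = 0 -> Jpsi x0 u0 *m d = 0.
Proof.
move=> Ad; apply/colP => i; rewrite !mxE.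
under eq_bigr => j _ do rewrite mxE.
apply: (derive_differentiable_eq0 (differentiable_psi u0 i x0)) => t.
by rewrite (@psi_Amx _ x0) // mulmxDr -scalemxAr Ad scaler0 add0r.
Qed.

Lemma Jf_invK x0 u0 : Jf_sq x0 u0 \in unitmx ->
  Jf x0 u0 *m Jf_inv x0 u0 = 1%:M /\ Jf_inv x0 u0 *m Jf x0 u0 = 1%:M.
Proof. exact: castmx_inv. Qed.

Lemma Amx_left_inverse x0 u0 : Jf_sq x0 u0 \in unitmx ->
  exists B : 'M[R]_(nx N, nz N), B *m Amx N = 1%:M.
Proof.
move=> /Jf_invK [_ JJ].
have inj d : Amx N *m d = 0 -> d = 0.
  move=> /(Jpsi_ker x0 u0) Jd; rewrite -[d]mul1mx -JJ /Jf -!mulmxA Jd.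
  by rewrite !mulmx0.
(* Injectivity on columns is row freeness of the transpose, for which [pinvmx] is a right
   inverse. *)
have free : row_free (Amx N)^T.
  rewrite -kermx_eq0; apply/eqP/row_matrixP => i; rewrite row0.
  apply: trmx_inj; rewrite trmx0; apply: inj; apply: trmx_inj.
  by rewrite trmx_mul trmxK -row_mul mulmx_ker row0 trmx0.
exists (pinvmx (Amx N)^T)^T; apply: trmx_inj.
by rewrite trmx_mul trmxK mulmxVp // trmx1.
Qed.

Lemma bus_v_le (a b : 'cV[R]_(npq N)) u k : lev a b -> bus_v a u k <= bus_v b u k.
Proof.
by move=> ab; rewrite /bus_v; case: pickP => // _; case: pickP.
Qed.

(** The ends of a line are distinct, so one of them is not the reference bus, and its angle alone
    can produce any angle difference. Such states allow the envelope inequalities to be read at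
    prescribed arguments. *)
Lemma x_phi_surj l (c : R) (v : 'cV[R]_(npq N)) : exists x, x_phi x l 0 = c /\ x_vpq x
  = v.
Proof.
have [k [ck]] : exists j : 'I_(nb.-1), (ns_rows N (incidence N))^T l j != 0.
  have [r|r] := eqVneq (line_from N l) (ref_bus N).
    have [j Ej _] : exists2 j, line_to N l = lift (ref_bus N) j & True.
      by case: (unliftP (ref_bus N) (line_to N l)) => [j ->|E];
        [exists j|have := line_from_neq_to N l; rewrite r E eqxx].
    exists j; rewrite !mxE Ej r eqxx [_ == ref_bus N]eq_sym (negPf (neq_lift _ _))
      sub0r oppr_eq0.
    exact: oner_neq0.
  have [j Ej _] : exists2 j, line_from N l = lift (ref_bus N) j & True.
    by case: (unliftP (ref_bus N) (line_from N l)) r => [j ->|->];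
      [exists j|rewrite eqxx].
  exists j; have := line_from_neq_to N l; rewrite !mxE Ej eqxx => /negPf ->.
  by rewrite subr0; exact: oner_neq0.
set E := (ns_rows N (incidence N))^T in ck *.
exists (col_mx (\col_j if j == k then c / E l k else 0) (col_mx v 0)).
rewrite /x_phi /x_vpq /x_theta !(col_mxKu, col_mxKd); split => //.
rewrite mxE (bigD1 k) //= mxE eqxx big1 => [|j jk];
  last by rewrite mxE (negPf jk) mulr0.
by rewrite addr0 mulrC divfK.
Qed.
End Network.

(** * Residual bounds obtained from the envelopes *)

Lemma lev_blocks (R : realType) (nb nl ng : nat) (g h : 'cV[R]_(npsi nb nl ng)) :
  lev (blk_p g) (blk_p h) -> lev (blk_cos g) (blk_cos h) ->
  lev (blk_sin g) (blk_sin h) -> lev (blk_quad g) (blk_quad h) -> lev g h.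
Proof.
move=> h1 h2 h3 h4 i.
case: (split_ordP i) => {}i ->; first by have := h1 i; rewrite !mxE.
case: (split_ordP i) => {}i ->; first by have := h2 i; rewrite !mxE.
case: (split_ordP i) => {}i ->; first by have := h3 i; rewrite !mxE.
by have := h4 i; rewrite !mxE.
Qed.

Section Envelopes.
Variables (R : realType) (nb nl ng nd : nat) (N : network R nb nl ng nd).
Variables (x0 : 'cV[R]_(nx N)) (u0 u : 'cV[R]_(ng + ng)).
Variables (e : envelopes R nb nl ng) (zu zl : 'cV[R]_(nz N)) (gu gl : 'cV[R]_(npsi nb
  nl ng)).
Hypothesis Henv : envelope_bounds x0 u0 e.
Hypothesis Hu : dispatch_point N u.
Hypothesis Hz : lev zl zu.
Hypothesis Hlim : within_limits u zu zl.
Hypothesis Hvert : vertex_bounds e u zu zl gu gl.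

Lemma lev_z_phi (a b : 'cV[R]_(nz N)) : lev a b -> lev (z_phi a) (z_phi b).
Proof. by move=> ab i; rewrite !mxE. Qed.

Lemma lev_z_vpq (a b : 'cV[R]_(nz N)) : lev a b -> lev (z_vpq a) (z_vpq b).
Proof. by move=> ab i; rewrite !mxE. Qed.

Let vl_le_vu k : bus_v (z_vpq zl) u k <= bus_v (z_vpq zu) u k.
Proof. exact/bus_v_le/lev_z_vpq. Qed.

Let vl_ok k : vmin N k 0 <= bus_v (z_vpq zl) u k <= vmax N k 0.
Proof. by have [v1 v2] := Hlim.1 k; rewrite v1 (le_trans (vl_le_vu k)). Qed.

(* The residual at a state with corner values of [v] and [phi_l] lies between both
   bounds; such a state exists for each component separately. *)
Lemma residual_bounds_ordered : lev gl gu.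
Proof.
have [V1 V2 V3] := Hvert.
apply: lev_blocks => [i|l|l|k].
- have [E _ _] := Henv (0 : 'cV[R]_(nx N)) Hu; have [v1 v2] := V1 i;
    have /andP[e1 e2] := E i.
  by apply: le_trans v1 (le_trans e1 (le_trans e2 v2)).
- have [x [xphi xv]] := x_phi_surj l (z_phi zl l 0) (z_vpq zl).
  have [_ E _] := Henv x Hu; have [p1 p2] := Hlim.2 l.
  have [] := E l; rewrite ?xv ?xphi // ?p1 ?(le_trans (lev_z_phi Hz l)) //.
  move=> /andP[e1 e2] _.
  have [||| v1 v2 _ _] := V2 l (bus_v (z_vpq zl) u (line_from N l)) (bus_v (z_vpq zl)
    u (line_to N l)) (z_phi zl l 0); rewrite ?inE ?eqxx //.
  by apply: le_trans v1 (le_trans e1 (le_trans e2 v2)).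
- have [x [xphi xv]] := x_phi_surj l (z_phi zl l 0) (z_vpq zl).
  have [_ E _] := Henv x Hu; have [p1 p2] := Hlim.2 l.
  have [] := E l; rewrite ?xv ?xphi // ?p1 ?(le_trans (lev_z_phi Hz l)) //.
  move=> _ /andP[e1 e2].
  have [||| _ _ v1 v2] := V2 l (bus_v (z_vpq zl) u (line_from N l)) (bus_v (z_vpq zl)
    u (line_to N l)) (z_phi zl l 0); rewrite ?inE ?eqxx //.
  by apply: le_trans v1 (le_trans e1 (le_trans e2 v2)).
- pose x : 'cV[R]_(nx N) := col_mx 0 (col_mx (z_vpq zl) 0).
  have xv : x_vpq x = z_vpq zl by rewrite /x_vpq col_mxKd col_mxKu.
  have [_ _ E] := Henv x Hu; have := E k; rewrite xv => /(_ (vl_ok k)) /andP[e1 e2].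
  have [|v1 v2] := V3 k (bus_v (z_vpq zl) u k); rewrite ?inE ?eqxx //.
  by apply: le_trans v1 (le_trans e1 (le_trans e2 v2)).
Qed.

Hypothesis Hshape : envelope_shape e.

(** The state bounds lie within the operational limits, so the envelopes are valid at [x]; concavity
    of the lower and convexity of the upper ones extend the vertex inequalities to [x]. The active
    power block needs no vertices, as its argument is fixed by [u]. *)
Lemma residual_within_bounds (x : 'cV[R]_(nx N)) : state_set zu zl x ->
  lev gl (residual x0 u0 x u) /\ lev (residual x0 u0 x u) gu.
Proof.
move=> [/= xl xu]; have [V1 V2 V3] := Hvert; have [E1 E2 E3] := Henv x Hu.
have phix : z_phi (Amx N *m x) = x_phi x by rewrite Amx_mulE /z_phi col_mxKu.
have vx : z_vpq (Amx N *m x) = x_vpq x by rewrite Amx_mulE /z_vpq col_mxKd.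
have phi_in l : z_phi zl l 0 <= x_phi x l 0 <= z_phi zu l 0.
  by rewrite -phix !lev_z_phi.
have v_in k : bus_v (z_vpq zl) u k <= bus_v (x_vpq x) u k <= bus_v (z_vpq zu) u k.
  by rewrite -vx !bus_v_le //; exact: lev_z_vpq.
have phi_ok l : phimin N l 0 <= x_phi x l 0 <= phimax N l 0.
  have [p1 p2] := Hlim.2 l; have /andP[q1 q2] := phi_in l.
  by rewrite (le_trans p1 q1) (le_trans q2 p2).
have v_ok k : vmin N k 0 <= bus_v (x_vpq x) u k <= vmax N k 0.
  have [p1 p2] := Hlim.1 k; have /andP[q1 q2] := v_in k.
  by rewrite (le_trans p1 q1) (le_trans q2 p2).
have line l := E2 l (v_ok _) (v_ok _) (phi_ok l).
split; apply: lev_blocks => [i|l|l|k].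
- by have [v1 _] := V1 i; have /andP[e1 _] := E1 i; exact: le_trans v1 e1.
- have [/andP[e1 _] _] := line l; apply: le_trans e1.
  apply: (concave3_ge (gcos_lo_concave Hshape l) (v_in _) (v_in _) (phi_in l)) => y1
    y2 y3 h1 h2 h3.
  by case: (V2 l y1 y2 y3 h1 h2 h3).
- have [_ /andP[e1 _]] := line l; apply: le_trans e1.
  apply: (concave3_ge (gsin_lo_concave Hshape l) (v_in _) (v_in _) (phi_in l)) => y1
    y2 y3 h1 h2 h3.
  by case: (V2 l y1 y2 y3 h1 h2 h3).
- have /andP[e1 _] := E3 k (v_ok k); apply: le_trans e1.
  by apply: (concave1_ge (gv_lo_concave Hshape k) (v_in k)) => y /V3[].
- by have [_ v1] := V1 i; have /andP[_ e1] := E1 i; exact: le_trans e1 v1.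
- have [/andP[_ e1] _] := line l; apply: le_trans e1 _.
  apply: (convex3_le (gcos_up_convex Hshape l) (v_in _) (v_in _) (phi_in l)) => y1 y2
    y3 h1 h2 h3.
  by case: (V2 l y1 y2 y3 h1 h2 h3).
- have [_ /andP[_ e1]] := line l; apply: le_trans e1 _.
  apply: (convex3_le (gsin_up_convex Hshape l) (v_in _) (v_in _) (phi_in l)) => y1 y2
    y3 h1 h2 h3.
  by case: (V2 l y1 y2 y3 h1 h2 h3).
- have /andP[_ e1] := E3 k (v_ok k); apply: le_trans e1 _.
  by apply: (convex1_le (gv_up_convex Hshape k) (v_in k)) => y /V3[].
Qed.
End Envelopes.

(** * Continuity of the residual and the fixed-point argument *)

Lemma continuous_mulmx (R : realType) m n (B : 'M[R]_(m, n)) :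
  continuous (fun z : 'cV[R]_n => B *m z).
Proof.
apply: continuous_mx => i k; rewrite (ord1 k).
under [fun z => _]funext => z do rewrite mxE.
apply: continuous_sum => j; apply: continuous_mul; first exact: continuous_cst.
exact: coord_continuous.
Qed.

Lemma continuous_residual (R : realType) (nb nl ng nd : nat) (N : network R nb nl ng nd)
    (x0 : 'cV[R]_(nx N)) u0 u i :
  continuous (fun x : 'cV[R]_(nx N) => residual x0 u0 x u i 0).
Proof.
under [fun x => _]funext => x do rewrite mxE [X in _ + X]mxE.
apply: continuous_add; first exact: continuous_psi.
move=> x; apply: continuousN.
apply: (@continuous_comp _ _ _ (fun x => Jpsi x0 u0 *m x) (fun y : 'cV[R]__ => y i 0)).
  exact: continuous_mulmx.
exact: coord_continuous.
Qed.

Theorem theorem1 (R : realType) (nb nl ng nd : nat)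
  (N : network R nb nl ng nd)
  (Sigma Sigma_half : 'M[R]_(nd + nd))
  (HSigma : sym_posdef Sigma)
  (Hchol : cholesky_factor Sigma Sigma_half)
  (x0 : 'cV[R]_(nx N)) (u0 : 'cV[R]_(ng + ng)) (w0 : 'cV[R]_(nd + nd))
  (Hu0 : dispatch_point N u0)
  (Hnominal : power_flow x0 u0 w0)
  (HJf : Jf_sq x0 u0 \in unitmx)
  (e : envelopes R nb nl ng)
  (Hshape : envelope_shape e)
  (Henv : envelope_bounds x0 u0 e)
  (u : 'cV[R]_(ng + ng)) (Hu : dispatch_point N u)
  (gamma : R) (Hgamma : 0 <= gamma)
  (zu zl : 'cV[R]_(nz N)) (gu gl : 'cV[R]_(npsi nb nl ng))
  (Hz : lev zl zu)
  (Hlim : within_limits u zu zl)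
  (Hvert : vertex_bounds e u zu zl gu gl)
  (Hup : lev (pos_part (Kmx x0 u0) *m gu + neg_part (Kmx x0 u0) *m gl
                + xi_up x0 u0 w0 Sigma_half gamma) zu)
  (Hlo : lev zl (pos_part (Kmx x0 u0) *m gl + neg_part (Kmx x0 u0) *m gu
                + xi_lo x0 u0 w0 Sigma_half gamma)) :
  forall w : 'cV[R]_(nd + nd), uncertainty_set w0 Sigma gamma w ->
  exists x : 'cV[R]_(nx N), state_set zu zl x /\ power_flow x u w.
Proof.
move=> w Hw.
have [B BA] := Amx_left_inverse HJf.
have [JJi JiJ] := Jf_invK HJf.
(* Truncation lands in the interval only if the interval is nonempty. *)
have glu := residual_bounds_ordered Henv Hu Hz Hlim Hvert.
pose Ji := Jf_inv x0 u0.
pose c (x : 'cV[R]_(nx N)) : 'cV[R]_(npsi nb nl ng) :=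
  \col_i Num.max (gl i 0) (Num.min (gu i 0) (residual x0 u0 x u i 0)).
have c_in x : lev gl (c x) /\ lev (c x) gu.
  by split=> i; rewrite mxE ?le_max ?lexx // ge_max glu ge_min lexx.
(* The map on states is transported by [Amx] and its left inverse [B] to the space of [z], where the
   state bounds form a box. *)
pose S (z : 'cV[R]_(nz N)) := - (Ji *m (Mmx N *m c (B *m z) + Rmx N *m w)).
pose H z := Amx N *m S z.
have HE z : H z = Kmx x0 u0 *m c (B *m z) - Amx N *m Ji *m Rmx N *m w.
  by rewrite /H /S /Kmx mulmxN [X in _ = X - _]mulNmx -opprD; congr (- _);
    rewrite !mulmxDr !mulmxA.
(* As [w] ranges over the ellipsoid, this linear term deviates from its value at [w0] by at most the
   norm term of [xi_up] and [xi_lo]. *)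
have xi_bounds i :
    xi_lo x0 u0 w0 Sigma_half gamma i 0 <= - (Amx N *m Ji *m Rmx N *m w) i 0
      <= xi_up x0 u0 w0 Sigma_half gamma i 0.
  have := ellipsoid_le (row i (Amx N) *m Ji *m Rmx N) Hchol Hgamma Hw.
  set a := row i (Amx N) *m Ji *m Rmx N;
    have -> : (a *m (w - w0)) 0 0 = (a *m w) 0 0 - (a *m w0) 0 0.
    by rewrite mulmxBr !mxE.
  rewrite ler_norml => /andP[h1 h2].
  have -> : (Amx N *m Ji *m Rmx N *m w) i 0 = (a *m w) 0 0.
    by rewrite /a -!row_mul [RHS]mxE.
  by rewrite /xi_lo /xi_up [X in X <= _ <= _]mxE [X in _ <= _ <= X]mxE -/Ji -/a;
    apply/andP; split; lra.
(* Because of the truncation this holds for every [z], inside the box or not. *)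
have H_in z : lev zl (H z) /\ lev (H z) zu.
  have [cl cu] := c_in (B *m z); have [K1 K2] := interval_mulmx_le (Kmx x0 u0) cl cu.
  split=> i; rewrite HE; have /andP[x1 x2] := xi_bounds i.
    apply: le_trans (Hlo i) _;
      rewrite [X in X <= _]mxE [X in _ <= X]mxE [X in _ <= _ + X]mxE.
    by rewrite lerD // K2.
  apply: le_trans (Hup i);
    rewrite [X in X <= _]mxE [X in _ <= X]mxE [X in _ + X <= _]mxE.
  by rewrite lerD // K1.
have cH i : continuous (fun z => H z i 0).
  have -> : (fun z => H z i 0) = fun z => \sum_j Kmx x0 u0 i j * Num.max (gl j 0)
      (Num.min (gu j 0) (residual x0 u0 (B *m z) u j 0)) - (Amx N *m Ji *m Rmx N *m w)
        i 0.
    apply/funext => z; rewrite HE [LHS]mxE [X in X + _]mxE [X in _ + X = _]mxE;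
      congr (_ - _).
    by apply: eq_bigr => j _; rewrite [c _ j 0]mxE.
  apply: continuous_add; last exact: continuous_cst.
  apply: continuous_sum => j; apply: continuous_mul; first exact: continuous_cst.
  apply: continuous_clip; move=> z.
  apply: (@continuous_comp _ _ _ (fun z => B *m z) (fun x => residual x0 u0 x u j 0)).
    exact: continuous_mulmx.
  exact: continuous_residual.
have [z [zl_le zu_ge Hz_fix]] := brouwer_box Hz cH (fun z _ _ => H_in z).
(* Taking [S z] rather than [B *m z] as the state puts [z] in the range of [Amx], and then the two
   agree. *)
pose x := S z; have Ax : Amx N *m x = z by exact: Hz_fix.
have Bz : B *m z = x by rewrite -Ax mulmxA BA mul1mx.
have xP : state_set zu zl x by rewrite /state_set /= Ax.
exists x; split => //.
have [r1 r2] := residual_within_bounds Henv Hu Hlim Hvert Hshape xP.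
have cx : c x = residual x0 u0 x u.
  by apply/colP => i; rewrite mxE min_r // max_r.
(* With the truncation inactive, [Mmx N *m c x] equals [Mmx N *m psi x u - Jf x0 u0 *m x], so the
   terms in [Jf] cancel and the power flow equations remain. *)
have : Jf x0 u0 *m x = - (Mmx N *m c x + Rmx N *m w).
  by rewrite {1}/x /S Bz mulmxN mulmxA JJi mul1mx.
rewrite cx /residual mulmxBr mulmxA -/(Jf x0 u0) /power_flow => E.
apply/eqP; rewrite -subr_eq0 subr0; apply/eqP.
have := congr1 (fun y => - y + Jf x0 u0 *m x) E; rewrite opprK addNr => ->.
by rewrite addrAC addrNK.
Qed.
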